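(* Let $\mathcal{G}=(\mathcal{V},\mathcal{E})$ be a map graph, let $\mathcal{G}_i=(\mathcal{V}_i,\mathcal{E}_i)$, $1\le i\le K$, be subgraphs of $\mathcal{G}$ forming a cover of $\mathcal{G}$, and let $\mathcal{K}$ be the cover complex of $\{\mathcal{G}_1,\dots,\mathcal{G}_K\}$. Then $\mathcal{G}$ is cycle consistent if 1. $\mathcal{G}_i$ is cycle consistent for every $i\in\{1,\dots,K\}$; 2. $\mathcal{G}_i$ and $\mathcal{G}_j$ are joint normal for every edge $\{i,j\}$ of $\mathcal{K}$, i.e. for all $i\neq j$ with $\mathcal{V}_i\cap\mathcal{V}_j\neq\varnothing$; 3. $\mathcal{K}$ is simply connected.
   Context: **Map graph.** A map graph $\mathcal{G}=(\mathcal{V},\mathcal{E})$ is a finite undirected graph whose vertices are objects $\mathcal{V}=\{H_1,\dots,H_n\}$, each object $H_i$ being given by $m$ points (the same $m$ for all $i$). The edge set $\mathcal{E}$ connects a subset of the pairs of objects, and each edge $(i,j)\in\mathcal{E}$, joining $H_i$ and $H_j$, is associated with a bijection (''permutation'') $\phi_{ij}:H_i\to H_j$. The map for traversing the edge in the reverse direction is $\phi_{ji}=\phi_{ij}^{-1}$. A subgraph of $\mathcal{G}$ is regarded as a map graph with the same maps on its edges. **Cycle consistency.** A map graph is cycle consistent if for every vertex $v_i$ and every cycle $v_i - v_{i_1}-\cdots-v_{i_k}-v_i$ in the graph, the composition of the maps $\phi_{i i_1},\phi_{i_1 i_2},\dots,\phi_{i_k i}$ along the cycle is the identity map. **Cover.**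 Subgraphs $\mathcal{G}_i=(\mathcal{V}_i,\mathcal{E}_i)$, $1\le i\le K$, of $\mathcal{G}$ form a cover of $\mathcal{G}$ if $\bigcup_{i=1}^K\mathcal{V}_i=\mathcal{V}$. **Joint normal.** Two subgraphs $\mathcal{G}_i=(\mathcal{V}_i,\mathcal{E}_i)$ and $\mathcal{G}_j=(\mathcal{V}_j,\mathcal{E}_j)$ of $\mathcal{G}$ are joint normal if (a) their common subgraph $(\mathcal{V}_i\cap\mathcal{V}_j,\ \mathcal{E}_i\cap\mathcal{E}_j)$ is either empty or connected, and (b) no edge of $\mathcal{E}$ connects a vertex of $\mathcal{V}_i\setminus\mathcal{V}_j$ with a vertex of $\mathcal{V}_j\setminus\mathcal{V}_i$, i.e. $(s,t)\notin\mathcal{E}$ for all $H_s\in\mathcal{V}_i\setminus\mathcal{V}_j$ and $H_t\in\mathcal{V}_j\setminus\mathcal{V}_i$. **Cover complex.** The cover complex $\mathcal{K}$ of $\{\mathcal{G}_i\}_{1\le i\le K}$ is the abstract simplicial complex on the index set $\{1,\dots,K\}$ whose simplices are the nonempty subsets $\{i_1,\dots,i_k\}\subset\{1,\dots,K\}$ with $\mathcal{V}_{i_1}\cap\cdots\cap\mathcal{V}_{i_k}\neq\varnothing$ (the nerve of the vertex sets). **Simply connected.** $\mathcal{K}$ is simply connected in the usual topological sense: its geometric realization is path connected and every closed curve in it can be deformed to a point.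
   Formalization: The formal theorem also assumes that every edge of G lies in some subgraph G_i; with only the vertices covered the claim fails, e.g. for a 4-cycle with one swap map covered by the other three edges taken as subgraphs. *)

(* Defs.v *)
From HB Require Import structures.
From mathcomp Require Import all_boot all_order all_algebra.
From mathcomp Require Import all_classical all_reals all_analysis.

Set Implicit Arguments.
Unset Strict Implicit.
Unset Printing Implicit Defensive.

Import Order.TTheory GRing.Theory Num.Theory.
Import numFieldNormedType.Exports.

Local Open Scope ring_scope.

(* The vertices H_1, ..., H_n are indexed by 'I_n and [points i] is the set of
   the m points of H_i. The map [phi i j] is meaningful only when [edge i j];
   as [edge] is symmetric, [phiK] makes it a bijection with inverse
   [phi j i]. On non-edges [phi] is an unused dummy function, which exists
   since all the objects have the same number of points. *)
Record map_graph (n m : nat) := MapGraph {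
  points : 'I_n -> finType;
  card_points : forall i, #|points i| = m;
  edge : rel 'I_n;
  edge_sym : symmetric edge;
  edge_irrefl : irreflexive edge;
  phi : forall i j, points i -> points j;
  phiK : forall i j, edge i j -> cancel (@phi i j) (@phi j i)
}.
Arguments phi {n m} G i j _ : rename.

Record subgraph (n m : nat) (G : map_graph n m) := Subgraph {
  sverts : {set 'I_n};
  sedge : rel 'I_n;
  sedge_sym : symmetric sedge;
  sedge_edge : forall u v, sedge u v -> edge G u v;
  sedge_verts : forall u v, sedge u v -> u \in sverts /\ v \in sverts
}.

(* Composition of the maps along i - k_1 - ... - k_r - j, with
   p = [:: k_1; ...; k_r]. *)
Fixpoint map_along (n m : nat) (G : map_graph n m)
    (i : 'I_n) (p : seq 'I_n) (j : 'I_n) : points G i -> points G j :=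
  if p is k :: q then @map_along n m G k q j \o phi G i k else phi G i j.
Arguments map_along {n m} G i p j _.

(* Cycles are simple cycles ([ucycle]: consecutive vertices of i :: p, including
   the last and the first one, are adjacent and all the vertices are distinct).
   The degenerate cycle i - j - i is allowed and harmless by [phiK]. A subgraph
   carries the maps of G, so that its cycle consistency only depends on its
   edge relation [e]. *)
Definition cycle_consistent_on (n m : nat) (G : map_graph n m)
    (e : rel 'I_n) : Prop :=
  forall (i : 'I_n) (p : seq 'I_n),
    ucycle e (i :: p) -> map_along G i p i =1 id.

Definition cycle_consistent (n m : nat) (G : map_graph n m) : Prop :=
  cycle_consistent_on G (edge G).

Definition sub_cycle_consistent (n m : nat) (G : map_graph n m)
    (S : subgraph G) : Prop :=
  cycle_consistent_on G (sedge S).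

Definition covers_vertices (n m K : nat) (G : map_graph n m)
    (S : 'I_K -> subgraph G) : Prop :=
  (\bigcup_(i < K) sverts (S i))%SET = [set: 'I_n]%SET.

(* Covering the vertices does not suffice for the gluing theorem, because joint
   normality says nothing about edges between disjoint subgraphs: in the
   4-cycle x - a - b - y - x, the three subgraphs x - a, a - b and b - y cover
   the vertices, are pairwise joint normal when they meet and have a path as
   their cover complex, but they do not constrain the map of the edge
   y - x. *)
Definition covers_edges (n m K : nat) (G : map_graph n m)
    (S : 'I_K -> subgraph G) : Prop :=
  forall u v, edge G u v -> exists i, sedge (S i) u v.

Definition connected_on (n : nat) (V : {set 'I_n}) (e : rel 'I_n) : Prop :=
  {in V &, forall u v, connect e u v}.

Definition joint_normal (n m : nat) (G : map_graph n m)
    (S T : subgraph G) : Prop :=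
  ((sverts S :&: sverts T)%SET = finset.set0 \/
   connected_on (sverts S :&: sverts T)%SET
     [rel u v | sedge S u v && sedge T u v]) /\
  (forall s t, s \in (sverts S :\: sverts T)%SET ->
     t \in (sverts T :\: sverts S)%SET -> ~~ edge G s t).

Definition cover_complex (n m K : nat) (G : map_graph n m)
    (S : 'I_K -> subgraph G) : {set {set 'I_K}} :=
  [set I : {set 'I_K} |
    (I != finset.set0) && ((\bigcap_(i in I) sverts (S i)) != finset.set0)]%SET.

(* Points of the realization are given by their barycentric coordinates. The
   complex being finite, the subspace topology is the usual one. *)
Definition realization (R : realType) (K : nat) (D : {set {set 'I_K}}) :
    set 'rV[R]_K :=
  fun x => [/\ forall i, 0 <= x 0 i,
               \sum_i x 0 i = 1 &
               [set i | x 0 i != 0]%SET \in D].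

Arguments realization R {K} D _.

Local Open Scope classical_set_scope.

Definition curve_in (R : realType) (T : topologicalType) (A : set T)
    (g : R -> T) : Prop :=
  {within `[0, 1], continuous g} /\ forall t : R, `[0, 1] t -> A (g t).

Definition path_connected (R : realType) (T : topologicalType)
    (A : set T) : Prop :=
  forall x y, A x -> A y ->
    exists g : R -> T, [/\ curve_in A g, g 0 = x & g 1 = y].

(* H (s, _) is the closed curve at time s of a deformation of g to a point. *)
Definition null_homotopic (R : realType) (T : topologicalType) (A : set T)
    (g : R -> T) : Prop :=
  exists (H : R * R -> T) (p : T),
  [/\ {within `[0, 1] `*` `[0, 1], continuous H},
      forall s t : R, `[0, 1] s -> `[0, 1] t -> A (H (s, t)),
      forall t : R, `[0, 1] t -> H (0, t) = g t,
      forall t : R, `[0, 1] t -> H (1, t) = p &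
      forall s : R, `[0, 1] s -> H (s, 0) = H (s, 1)].

Definition simply_connected (R : realType) (T : topologicalType)
    (A : set T) : Prop :=
  path_connected R A /\
  forall g : R -> T, curve_in A g -> g 0 = g 1 -> null_homotopic A g.

Definition simply_connected_complex (R : realType) (K : nat)
    (D : {set {set 'I_K}}) : Prop :=
  simply_connected R (realization R D).

(* Main.v *)
(* On each G_i, cycle consistency gives a flat trivialization: bijections f_i v
   from the points of v to {1, ..., m} that commute with the maps of the edges.
   Since the common subgraph of G_i and G_j is connected, f_j and f_i differ on
   it by a single permutation g_ij, even when G_i itself is not connected. A
   point shared by three objects shows that g is a cocycle on K. Simple
   connectedness makes g a coboundary, and the corresponding correction of the
   f_i makes them agree on the overlaps; the resulting global flat
   trivialization is the consistency of G.

   That a cocycle has trivial holonomy along a closed edge path is proved by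
   contracting the polygonal curve of this path. On a fine enough grid of the
   homotopy square, label each point with a vertex having barycentric coordinate
   at least 1/K: the four labels of a small square span a simplex, hence the
   holonomy along a row of labels does not depend, up to conjugation, on the
   row, and it is trivial on the last one. *)

Require Import Defs.
From mathcomp Require Import all_boot all_order all_algebra all_fingroup.
From mathcomp Require Import all_classical all_reals all_analysis zify ring lra.

Set Implicit Arguments.
Unset Strict Implicit.
Unset Printing Implicit Defensive.

Import Order.TTheory GRing.Theory Num.Theory.
Import numFieldNormedType.Exports.

(** * Cocycles and their holonomy along walks *)

Definition cocycle_on (I : finType) (gT : groupType) (D : {set {set I}})
    (g : I -> I -> gT) : Prop :=
  forall sigma i j k, sigma \in D -> i \in sigma -> j \in sigma ->
    k \in sigma -> (g i j * g j k)%g = g i k.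

(** Walks are functions on [nat] because grid rows and subdivided paths are given by their index. *)
Fixpoint walk_holonomy (I : Type) (gT : groupType) (g : I -> I -> gT)
    (l : nat -> I) (N : nat) : gT :=
  if N is b.+1 then (walk_holonomy g l b * g (l b) (l b.+1))%g else 1%g.

Lemma cocycle_id (I : finType) (gT : groupType) (D : {set {set I}})
    (g : I -> I -> gT) (sigma : {set I}) (i : I) :
  cocycle_on D g -> sigma \in D -> i \in sigma -> g i i = 1%g.
Proof.
move=> gD sD i_s; apply: (mulgI (g i i)).
by rewrite (gD sigma) // mulg1.
Qed.

Lemma eq_walk_holonomy (I : Type) (gT : groupType) (g : I -> I -> gT)
    (k l : nat -> I) (N : nat) :
  (forall b, (b <= N)%N -> k b = l b) ->
  walk_holonomy g k N = walk_holonomy g l N.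
Proof.
elim: N => //= N IHN kl; rewrite !kl // IHN // => b bN.
by apply: kl; exact: leqW.
Qed.

(** Both ways around a square of the ladder give [g (k b) (l b.+1)], as its four corners lie in one
    simplex; the inner rungs then cancel. *)
Lemma walk_holonomy_ladder (I : finType) (gT : groupType) (D : {set {set I}})
    (g : I -> I -> gT) (k l : nat -> I) (N : nat) :
    cocycle_on D g ->
    (forall b, (b < N)%N -> exists2 sigma, sigma \in D &
       [/\ k b \in sigma, k b.+1 \in sigma, l b \in sigma & l b.+1 \in sigma]) ->
  (walk_holonomy g k N * g (k N) (l N) = g (k 0) (l 0) * walk_holonomy g l N)%g.
Proof.
move=> gD; elim: N => [|N IHN] rungs; first by rewrite /= mulg1 mul1g.
have [sigma sD [kN kN1 lN lN1]] := rungs N (ltnSn N).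
rewrite /= -mulgA (gD sigma) // -(gD sigma (k N) (l N)) // mulgA IHN ?mulgA //.
by move=> b bN; apply: rungs; exact: ltnW.
Qed.

Lemma walk_holonomy_cst (I : finType) (gT : groupType) (D : {set {set I}})
    (g : I -> I -> gT) (l : nat -> I) (sigma : {set I}) (i : I) (N : nat) :
    cocycle_on D g -> sigma \in D -> i \in sigma ->
    (forall b, (b <= N)%N -> l b = i) ->
  walk_holonomy g l N = 1%g.
Proof.
move=> gD sD i_s; elim: N => //= N IHN li.
rewrite IHN => [|b bN]; last by apply: li; exact: leqW.
by rewrite !li // (cocycle_id gD sD) // mul1g.
Qed.

(** Repeating each label M times only inserts factors [g i i], which are 1. This brings an edge path
    to the time scale of a fine grid. *)
Lemma walk_holonomy_refine (I : finType) (gT : groupType) (D : {set {set I}})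
    (g : I -> I -> gT) (l : nat -> I) (r M : nat) :
    cocycle_on D g -> (0 < M)%N ->
    (forall q, (q < r)%N -> exists2 sigma, sigma \in D & l q \in sigma) ->
  walk_holonomy g (fun b => l (b %/ M)) (r * M) = walk_holonomy g l r.
Proof.
move=> gD M_gt0; elim: r => //= r IHr vert.
have [sigma sD lr] := vert r (ltnSn r).
rewrite -IHr => [|q qr]; last by apply: vert; exact: ltnW.
case: M M_gt0 {IHr} => // M _.
have block j : (j <= M)%N ->
    walk_holonomy g (fun b => l (b %/ M.+1)) (r * M.+1 + j) =
    walk_holonomy g (fun b => l (b %/ M.+1)) (r * M.+1).
  elim: j => [|j IHj] jM; first by rewrite addn0.
  rewrite addnS /= IHj; last exact: ltnW.
  rewrite -addnS !divnMDl // !divn_small ?addn0 //; last by rewrite ltnS ltnW.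
  by rewrite (cocycle_id gD sD) // mulg1.
rewrite mulSn addnC addnS /= block // -addnS -mulSnr mulnK //.
by rewrite divnMDl // divn_small // addn0.
Qed.

(** * Holonomy of edge paths and coboundaries *)

Fixpoint holonomy (I : Type) (gT : groupType) (g : I -> I -> gT) (i : I)
    (p : seq I) : gT :=
  if p is j :: q then (g i j * holonomy g j q)%g else 1%g.

Lemma holonomy_cat (I : Type) (gT : groupType) (g : I -> I -> gT) (i : I)
    (p q : seq I) :
  holonomy g i (p ++ q) = (holonomy g i p * holonomy g (last i p) q)%g.
Proof. by elim: p i => [|j p IHp] i /=; rewrite ?mul1g // IHp mulgA. Qed.

(** Take for [h i] the holonomy of a chosen path to [i] from the root of its component; triviality
    on closed paths makes it independent of the path. *)
Lemma coboundary (I : finType) (gT : groupType) (g : I -> I -> gT)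
    (e : rel I) : symmetric e ->
    (forall i p, path e i p -> last i p = i -> holonomy g i p = 1%g) ->
  exists h : I -> gT, forall i j, e i j -> (h i * g i j)%g = h j.
Proof.
move=> e_sym trivial.
have csym := sym_connect_sym e_sym.
have ex_path (i : I) : exists p,
    path e (fingraph.root e i) p /\ last (fingraph.root e i) p = i.
  have /connectP[p walk last_p] : connect e (fingraph.root e i) i.
    by rewrite csym connect_root.
  by exists p.
have [p pP] := choice ex_path.
exists (fun i => holonomy g (fingraph.root e i) (p i)) => i j ij.
have [[walki lasti] [walkj lastj]] := (pP i, pP j).
have eq_r : fingraph.root e j = fingraph.root e i.
  by apply/esym/(fingraph.rootP csym); exact: connect1.
rewrite eq_r in walkj lastj *.
have /connectP[q walkq lastq] : connect e j (fingraph.root e i).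
  by rewrite -eq_r connect_root.
(* The common return path [q] turns both sides into holonomies of closed paths at the root. *)
apply: (mulIg (holonomy g j q)); transitivity (1%g : gT).
  have := trivial (fingraph.root e i) (p i ++ j :: q).
  rewrite cat_path last_cat holonomy_cat lasti /= walki ij walkq -lastq mulgA.
  exact.
have := trivial (fingraph.root e i) (p j ++ q).
rewrite cat_path last_cat holonomy_cat lastj walkj walkq -lastq.
by move=> ->.
Qed.

Lemma nth_walk_holonomy (I : Type) (gT : groupType) (g : I -> I -> gT) (i : I)
    (p : seq I) :
  walk_holonomy g (fun k => nth i (i :: p) k) (size p) = holonomy g i p.
Proof.
suff H x :
    walk_holonomy g (fun k => nth x (i :: p) k) (size p) = holonomy g i p.
  exact: H.
elim/last_ind: p => //= p j IHp.
rewrite size_rcons -cats1 holonomy_cat /= mulg1; congr (_ * _)%g.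
  rewrite -IHp; apply: eq_walk_holonomy => b bp.
  by case: b bp => //= b bp; rewrite nth_cat bp.
congr (g _ _); last by rewrite nth_cat ltnn subnn.
by rewrite -cat_cons nth_cat ltnSn (last_nth x).
Qed.

(** * Maps along walks and flat trivializations *)

Lemma map_along_cat (n m : nat) (G : map_graph n m) (u : 'I_n) (p : seq 'I_n)
    (w : 'I_n) (q : seq 'I_n) (v : 'I_n) :
  map_along G u (p ++ w :: q) v =1 map_along G w q v \o map_along G u p w.
Proof. by elim: p u => [|k p IHp] u x //=; rewrite IHp. Qed.

Lemma map_along_inj (n m : nat) (G : map_graph n m) (u : 'I_n) (p : seq 'I_n)
    (v : 'I_n) :
  path (edge G) u (rcons p v) -> injective (map_along G u p v).
Proof.
elim: p u => [|k p IHp] u /=.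
  by rewrite andbT => /phiK/can_inj.
by case/andP=> /phiK/can_inj uk /IHp kp; exact: inj_comp.
Qed.

(** Strong induction on the length: a repeated vertex splits a closed walk into two shorter closed
    walks. *)
Lemma closed_walk_consistent (n m : nat) (G : map_graph n m) (e : rel 'I_n) :
  cycle_consistent_on G e ->
  forall (u : 'I_n) (p : seq 'I_n),
    path e u (rcons p u) -> map_along G u p u =1 id.
Proof.
move=> cons u p; have [k] := ubnP (size p).
elim: k u p => // k IHk u p /ltnSE le_pk walk x.
have [uniq_up|] := boolP (uniq (u :: p)).
  by apply: cons; rewrite /ucycle /= walk.
(* Either [u] recurs in [p] and the walk splits there, or some [w] occurs twice in [p] and the loop
   at [w] is cut out. *)
rewrite /= negb_and negbK => /orP[up|].
  case/splitPr: p / up le_pk walk x => p1 p2 le_pk walk x.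
  move: walk; rewrite rcons_cat /= cat_path /= => /and3P[walk1 e1 walk2].
  rewrite size_cat /= addnS in le_pk.
  rewrite map_along_cat /= IHk; last first.
  - by [].
  - by apply: leq_trans le_pk; rewrite ltnS leq_addl.
  rewrite IHk //; first by apply: leq_trans le_pk; rewrite ltnS leq_addr.
  by rewrite rcons_path walk1.
move=> nuniq_p.
have [w [p1 [p2 [p3 def_p]]]] : exists w p1 p2 p3,
    p = p1 ++ w :: p2 ++ w :: p3.
  elim: p nuniq_p {le_pk walk x} => //= a p IHp.
  rewrite negb_and negbK => /orP[ap|/IHp[w [p1 [p2 [p3 ->]]]]]; last first.
    by exists w, (a :: p1), p2, p3.
  by case/splitPr: p / ap {IHp} => p2 p3; exists a, [::], p2, p3.
move: walk le_pk x; rewrite def_p !(rcons_cat, rcons_cons).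
rewrite !(cat_path, size_cat) /= cat_path size_cat /=.
move=> /and4P[walk1 e1 walk2 /andP[e2 walk3]] le_pk x.
have lt_p2 : (size p2 < k)%N.
  lia.
rewrite map_along_cat /= map_along_cat /= (IHk w p2) //; last first.
  by rewrite rcons_path walk2.
rewrite -[LHS]/((map_along G w p3 u \o map_along G u p1 w) x) -map_along_cat.
apply: IHk.
  rewrite size_cat /=; lia.
by rewrite rcons_cat cat_path /= walk1 e1 walk3.
Qed.

Lemma card_bijection (n m : nat) (G : map_graph n m) (v : 'I_n) :
  exists b : points G v -> 'I_m, injective b.
Proof.
exists (cast_ord (card_points G v) \o enum_rank).
by move=> x y /cast_ord_inj/enum_rank_inj.
Qed.

Lemma inj_onto (n m : nat) (G : map_graph n m) (v : 'I_n)
    (f : points G v -> 'I_m) : injective f -> forall t, exists x, f x = t.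
Proof.
move=> f_inj t; have /codomP[x ->] : t \in codom f.
  by apply: inj_card_onto f_inj _ t; rewrite card_ord card_points.
by exists x.
Qed.

(** A bijection chosen at the root of each component is transported along walks; consistency makes
    the result independent of the walk. *)
Lemma flat_trivialization (n m : nat) (G : map_graph n m) (e : rel 'I_n) :
    symmetric e -> subrel e (edge G) -> cycle_consistent_on G e ->
  exists f : forall v, points G v -> 'I_m,
    (forall v, injective (f v)) /\
    (forall u v, e u v -> forall x, f v (phi G u v x) = f u x).
Proof.
move=> e_sym e_sub cons.
have csym := sym_connect_sym e_sym.
pose b v := sval (cid (card_bijection G v)).
have b_inj v : injective (b v) by exact: svalP (cid (card_bijection G v)).
have [f fP] : exists f : forall v, points G v -> 'I_m,
    forall v, injective (f v) /\
    forall p, path e (fingraph.root e v) (rcons p v) ->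
      forall x, f v (map_along G (fingraph.root e v) p v x) = b _ x.
  suff H v : exists fv : points G v -> 'I_m, injective fv /\
    forall p, path e (fingraph.root e v) (rcons p v) ->
      forall x, fv (map_along G (fingraph.root e v) p v x) = b _ x.
    by exists (fun v => sval (cid (H v))) => v; exact: svalP (cid (H v)).
  move: (fingraph.root e v) => r.
  (* [map_along] has no empty walk: if no nonempty walk joins r to v, the
     condition is void and any bijection will do. *)
  have [[p0 walk0]|none] := pselect (exists p, path e r (rcons p v)); last first.
    by exists (b v); split=> // p walk; case: none; exists p.
  have walk0' : path e v (rcons (rev p0) r).
    have := rev_path e r (rcons p0 v).
    rewrite last_rcons belast_rcons rev_cons => ->.
    by rewrite (eq_path (e' := e)) // => y z; rewrite e_sym.
  (* Preceded by any walk [p] from [r] to [v], the reverse of [p0] closes up a walk at [r], which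
     acts as the identity. *)
  exists (b r \o map_along G v (rev p0) r); split.
    apply: inj_comp (b_inj r) (map_along_inj _).
    exact: sub_path walk0'.
  move=> p walk x /=.
  rewrite -[map_along _ v _ r _]/((_ \o map_along G r p v) x) -map_along_cat.
  rewrite (closed_walk_consistent cons) // rcons_cat cat_path /=.
  by move: walk; rewrite rcons_path => /andP[-> ->].
exists f; split=> [v|u v uv x]; first by have [] := fP v.
have [[_ fu] [_ fv]] := (fP u, fP v).
have eq_r : fingraph.root e v = fingraph.root e u.
  by apply/esym/(fingraph.rootP csym); exact: connect1.
rewrite {}eq_r in fv.
(* The detour through [v] makes the walk nonempty even if [u] is the root. *)
have [p walk] : exists p, path e (fingraph.root e u) (rcons p u).
  have /connectP[q walk def_u] : connect e (fingraph.root e u) u.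
    by rewrite csym connect_root.
  exists (rcons q v); rewrite !rcons_path last_rcons walk -def_u uv /=.
  by rewrite e_sym.
have map_inj : injective (map_along G (fingraph.root e u) p u).
  by apply: map_along_inj; exact: sub_path walk.
have [y ->] : exists y, x = map_along G (fingraph.root e u) p u y.
  by apply/codomP/(inj_card_onto map_inj); rewrite !card_points.
rewrite (fu _ walk) -(fv (rcons p u)).
  by rewrite -cats1 map_along_cat.
by rewrite rcons_path walk last_rcons.
Qed.

Lemma trivialization_consistent (n m : nat) (G : map_graph n m) (e : rel 'I_n)
    (f : forall v, points G v -> 'I_m) :
    (forall v, injective (f v)) ->
    (forall u v, e u v -> forall x, f v (phi G u v x) = f u x) ->
  cycle_consistent_on G e.
Proof.
move=> f_inj f_flat i p /andP[walk _] x; apply: f_inj; move: walk => /=.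
suff H u : path e u (rcons p i) -> forall y, f i (map_along G u p i y) = f u y.
  by move=> walk; exact: H.
elim: p u => [|k p IHp] u /=; first by rewrite andbT => /f_flat.
by case/andP=> /f_flat uk /IHp kp y; rewrite kp uk.
Qed.

(** One vertex [v0] determines the permutation; flatness of both families propagates the equality
    along walks of the common subgraph. *)
Lemma transition (n m : nat) (G : map_graph n m) (S T : subgraph G)
    (f h : forall v, points G v -> 'I_m) :
    (sverts S :&: sverts T)%SET != finset.set0 ->
    connected_on (sverts S :&: sverts T)%SET
      [rel u v | sedge S u v && sedge T u v] ->
    (forall v, injective (f v)) -> (forall v, injective (h v)) ->
    (forall u v, sedge S u v -> forall x, f v (phi G u v x) = f u x) ->
    (forall u v, sedge T u v -> forall x, h v (phi G u v x) = h u x) ->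
  exists g : 'S_m, forall v, v \in (sverts S :&: sverts T)%SET ->
    forall x, g (f v x) = h v x.
Proof.
case/set0Pn=> v0 v0ST conn f_inj h_inj f_flat h_flat.
have [f' f'K] := choice (inj_onto (f_inj v0)).
have f'_inj : injective f' by move=> s t st; rewrite -(f'K s) st f'K.
pose g := perm (inj_comp (h_inj v0) f'_inj).
exists g => v vST; have /connectP[p walk ->] := conn _ _ v0ST vST.
suff H u : path [rel u v | sedge S u v && sedge T u v] u p ->
    (forall x, g (f u x) = h u x) ->
  forall x, g (f (last u p) x) = h (last u p) x.
  apply: H walk _ => x; rewrite permE /=; congr (h _ _).
  by apply: f_inj; rewrite f'K.
elim: p u {walk} => //= w p IHp u /andP[/andP[uwS uwT] walk] gu.
apply: IHp walk _ => x.
(* Every point over [w] comes from a point over [u], through the inverse map of the edge. *)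
have wu : edge G w u by rewrite edge_sym (sedge_edge uwS).
have <- : phi G u w (phi G w u x) = x by exact: phiK wu x.
by rewrite (f_flat _ _ uwS) gu (h_flat _ _ uwT).
Qed.

(** * Barycentric labels and holonomy along null-homotopic curves *)

Local Open Scope classical_set_scope.
Local Open Scope ring_scope.

(** Heine-Cantor theorem. Compactness is used in its near-covering form, for the filter of radii
    tending to 0 from the right. *)
Lemma uniformly_continuous_compact (R : realType) (T U : pseudoMetricType R)
    (A : set T) (f : T -> U) (e : R) :
    compact A -> {within A, continuous f} -> 0 < e ->
  exists2 d : R, 0 < d &
    forall x y, A x -> A y -> ball x d y -> ball (f x) e (f y).
Proof.
move=> /compact_near_coveringP coverA /subspace_continuousP f_cont e_gt0.
have e2_gt0 : 0 < e / 2 by rewrite divr_gt0.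
pose P (d : R) x := A x -> forall y, A y -> ball x d y -> ball (f x) e (f y).
have : \forall d \near 0^'+, A `<=` P d.
  apply: coverA => x Ax.
  have /fcvg_ballP/(_ _ e2_gt0) := f_cont x Ax.
  rewrite near_simpl /within /= => /nbhs_ballP[d /= d_gt0 near_x].
  (* Half of [d] is spent between [x] and [z], half between [z] and [y], so that both stay in
     [ball x d]. *)
  exists (ball x (d / 2), [set d' : R | d' < d / 2]).
    split; first by apply: nbhsx_ballx; rewrite divr_gt0.
    by apply: nbhs_right_lt; rewrite divr_gt0.
  move=> [z d'] /= [xz d'_lt] Az y Ay zy.
  have xz' : ball x d z by apply: le_ball xz; lra.
  have xy : ball x d y.
    rewrite [d]splitr; apply: ball_triangle xz _.
    by apply: le_ball zy; exact: ltW.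
  rewrite [e]splitr; apply: ball_triangle (near_x y xy Ay).
  by apply: ball_sym; exact: near_x.
move=> near_d.
have [d [AP d_gt0]] : exists d : R, A `<=` P d /\ 0 < d.
  apply: (@filter_ex _ (0^'+)); apply: filterI => //.
  exact: nbhs_right_gt.
by exists d => // x y Ax; exact: AP.
Qed.

Lemma continuous_mx (T R : topologicalType) (p q : nat)
    (f : T -> 'M[R]_(p, q)) :
  (forall i j, continuous (fun t => f t i j)) -> continuous f.
Proof.
move=> f_cont t U [P fP PU]; rewrite /nbhs /=.
have : \forall s \near t, forall i j, P i j (f s i j).
  apply: filter_forall => i; apply: filter_forall => j.
  exact: f_cont (fP i j).
by apply: filterS => s /PU.
Qed.

(* On the realization, some coordinate is at least 1/K and [i0] is never used;
   the lower bound makes the label of a point a vertex of the carrier of all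
   the points at distance less than 1/K. *)
Definition barycentric_label (R : realType) (K : nat) (i0 : 'I_K)
    (x : 'rV[R]_K) : 'I_K :=
  odflt i0 [pick i | K%:R^-1 <= x 0 i].

Lemma barycentric_label_close (R : realType) (K : nat) (D : {set {set 'I_K}})
    (i0 : 'I_K) (x y : 'rV[R]_K) :
    realization R D x -> ball y K%:R^-1 x ->
  y 0 (barycentric_label i0 x) != 0.
Proof.
move=> [_ sum_x _] /= [_ /(_ 0) yx]; rewrite /barycentric_label.
case: pickP => /= [i le_xi|lt_x].
  move: (yx i); rewrite /ball /= => h; apply/eqP => y0.
  by move: h; rewrite y0 sub0r normrN ltNge (le_trans le_xi) // ler_norm.
(* If no coordinate reached 1/K, their sum would be less than 1. *)
have: \sum_i x 0 i < \sum_(i < K) K%:R^-1.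
  apply: ltr_sum => [|i _]; last by rewrite ltNge lt_x.
  by apply/hasP; exists i0; rewrite ?mem_index_enum.
rewrite sum_x sumr_const card_ord -[_ *+ K]mulr_natl divff ?ltxx //.
by case: (K) i0 => [[]|k _] //; rewrite pnatr_eq0.
Qed.

(** Having all large N at hand allows N to be a multiple of the number of edges of a path. *)
Lemma null_homotopic_holonomy (R : realType) (K : nat) (gT : groupType)
    (D : {set {set 'I_K}}) (g : 'I_K -> 'I_K -> gT) (i0 : 'I_K)
    (c : R -> 'rV[R]_K) :
    cocycle_on D g -> null_homotopic (realization R D) c ->
  exists N0, forall N, (N0 < N)%N ->
    walk_holonomy g (fun b => barycentric_label i0 (c (b%:R / N%:R))) N = 1%g.
Proof.
move=> gD [H [p [H_cont H_in H0 H1 H01]]].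
have K_gt0 : 0 < K%:R^-1 :> R.
  by rewrite invr_gt0 ltr0n; case: (K) i0 => [[]|].
have square_compact : compact (`[0, 1] `*` `[0, 1] : set (R * R)).
  by apply: compact_setX; exact: segment_compact.
have [d d_gt0 H_unif] :=
  uniformly_continuous_compact square_compact H_cont K_gt0.
(* An N above the integer part of 1/d gives a grid of mesh 1/N < d. *)
exists (Num.truncn d^-1) => N N_large.
have N_gt0 : 0 < N%:R :> R by rewrite ltr0n (leq_trans _ N_large).
have Nd : N%:R^-1 < d.
  rewrite invf_plt ?posrE //; apply: lt_le_trans (truncnS_gt _) _.
  by rewrite ler_nat.
pose t b : R := b%:R / N%:R.
have t01 b : (b <= N)%N -> `[0, 1]%classic (t b).
  move=> bN; rewrite /= in_itv /= divr_ge0 ?ler0n // ler_pdivrMr // mul1r.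
  by rewrite ler_nat.
have tS b : ball (t b) d (t b.+1).
  rewrite /ball /= -mulrBl -natr1 opprD addNKr mulN1r normrN.
  by rewrite gtr0_norm // invr_gt0.
have t_refl b : ball (t b) d (t b) by exact: ballxx.
pose label a b := barycentric_label i0 (H (t a, t b)).
have corner a b a' b' :
    (a <= N)%N -> (b <= N)%N -> (a' <= N)%N -> (b' <= N)%N ->
    ball (t a) d (t a') -> ball (t b) d (t b') ->
    label a' b' \in [set i | H (t a, t b) 0 i != 0]%SET.
  move=> aN bN a'N b'N aa' bb'; rewrite inE.
  apply: (@barycentric_label_close _ _ D).
    by apply: H_in; exact: t01.
  by apply: H_unif; split=> //=; exact: t01.
have supp a b : (a <= N)%N -> (b <= N)%N ->
    [set i | H (t a, t b) 0 i != 0]%SET \in D.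
  by move=> aN bN; have [] := H_in _ _ (t01 a aN) (t01 b bN).
have t0 : t 0%N = 0 by rewrite /t mul0r.
have tN : t N = 1 by rewrite /t divff // gt_eqF.
(* Induction from the last row, where the curve is a point, back to row 0. *)
have trivial k : (k <= N)%N -> walk_holonomy g (label (N - k)%N) N = 1%g.
  elim: k => [_|k IHk kN].
    rewrite subn0.
    apply: (walk_holonomy_cst (i := label N 0%N) gD (supp N 0%N _ _)) => //.
      exact: corner.
    by move=> b bN; rewrite /label tN !H1 //; exact: t01.
  have aN : (N - k.+1 < N)%N by lia.
  have def_k : (N - k = (N - k.+1).+1)%N by lia.
  have := IHk (ltnW kN); rewrite def_k; set a := (N - k.+1)%N => IHa.
  (* The curve stays closed during the deformation, so the two end rungs of the ladder coincide. *)
  have closed a' : (a' <= N)%N -> label a' N = label a' 0%N.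
    by move=> a'N; rewrite /label tN t0 H01 //; exact: t01.
  have := @walk_holonomy_ladder _ _ D g (label a) (label a.+1) N gD.
  rewrite IHa !closed //; last exact: ltnW.
  rewrite mulg1 => ladder; apply: (mulIg (g (label a 0%N) (label a.+1 0%N))).
  rewrite mul1g; apply: ladder => b bN.
  (* The carrier of one corner of the square contains the labels of all four. *)
  exists [set i | H (t a, t b) 0 i != 0]%SET; first by apply: supp; exact: ltnW.
  by split; apply: corner => //; exact: ltnW.
rewrite -(trivial N) // subnn.
have eq_c b : (b <= N)%N -> barycentric_label i0 (c (t b)) = label 0%N b.
  by move=> bN; rewrite /label t0 H0 //; exact: t01.
by apply: eq_walk_holonomy.
Qed.

(** * Polygonal curves of edge walks *)

(* min(max(x, 0), 1), in a form whose continuity is that of the norm. *)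
Definition clamp (R : realType) (x : R) : R := (`|x| - `|x - 1| + 1) / 2.

Lemma clamp_id (R : realType) (x : R) : 0 <= x <= 1 -> clamp x = x.
Proof.
move=> /andP[x0 x1]; rewrite /clamp ger0_norm // ler0_norm; lra.
Qed.

Lemma clamp_le0 (R : realType) (x : R) : x <= 0 -> clamp x = 0.
Proof. by move=> x0; rewrite /clamp !ler0_norm; lra. Qed.

Lemma clamp_ge1 (R : realType) (x : R) : 1 <= x -> clamp x = 1.
Proof. by move=> x1; rewrite /clamp !ger0_norm; lra. Qed.

Lemma clamp_continuous (R : realType) : continuous (@clamp R).
Proof.
move=> x; apply: cvgM; last exact: cvg_cst.
apply: cvgD; last exact: cvg_cst.
apply: cvgB; first exact: norm_continuous.
apply: (@continuous_comp _ _ _ (fun x : R => x - 1) (fun y : R => `|y|)).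
  by apply: cvgB; [exact: cvg_id|exact: cvg_cst].
exact: norm_continuous.
Qed.

(* The polygonal curve through the vertices l 0, ..., l r, the
   vertex l k being reached at time k / r. *)
Definition polygon (R : realType) (K : nat) (l : nat -> 'I_K) (r : nat)
    (t : R) : 'rV[R]_K :=
  delta_mx 0 (l 0%N) +
  \sum_(0 <= k < r) clamp (r%:R * t - k%:R) *:
    (delta_mx 0 (l k.+1) - delta_mx 0 (l k)).

Lemma polygon_continuous (R : realType) (K : nat) (l : nat -> 'I_K) (r : nat) :
  continuous (polygon l r : R -> 'rV[R]_K).
Proof.
apply: continuous_mx => i j.
have -> : (fun t => polygon l r t i j) = (fun t : R =>
    (delta_mx 0 (l 0%N) : 'rV[R]_K) i j +
    \sum_(0 <= k < r) clamp (r%:R * t - k%:R) *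
    ((delta_mx 0 (l k.+1) - delta_mx 0 (l k) : 'rV[R]_K) i j)).
  apply/funext => t; rewrite mxE summxE; congr (_ + _).
  by apply: eq_bigr => k _; rewrite mxE.
move=> t; apply: cvgD; first exact: cvg_cst.
(* The speed is detached from the number of terms, so that it stays fixed in the induction. *)
move: r%:R => a; elim: r => [|n IHn].
  rewrite big_nil; under eq_fun do rewrite big_nil; exact: cvg_cst.
rewrite big_nat_recr //=; under eq_fun do rewrite big_nat_recr //=.
apply: cvgD IHn _; apply: cvgM; last exact: cvg_cst.
apply: (@continuous_comp _ _ _ (fun t : R => a * t - n%:R) (@clamp R)).
  apply: cvgB; last exact: cvg_cst.
  by apply: cvgM; [exact: cvg_cst|exact: cvg_id].
exact: clamp_continuous.
Qed.

(** At this time the steps before [q] are complete and telescope, step [q] is done in proportion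
    [f], and the later ones have not begun. *)
Lemma polygonE (R : realType) (K : nat) (l : nat -> 'I_K) (r q : nat) (t f : R) :
    (q < r)%N -> 0 <= f <= 1 -> r%:R * t = q%:R + f ->
  polygon l r t = (1 - f) *: delta_mx 0 (l q) + f *: delta_mx 0 (l q.+1).
Proof.
move=> qr /andP[f0 f1] def_t.
rewrite /polygon def_t.
have clampE k : clamp (q%:R + f - k%:R) =
    if (k < q)%N then 1 else if k == q then f else 0.
  case: ltngtP => [kq|qk|->].
  - by rewrite clamp_ge1 //; move: kq; rewrite -(ler_nat R) -natr1; lra.
  - by rewrite clamp_le0 //; move: qk; rewrite -(ler_nat R) -natr1; lra.
  - by rewrite clamp_id; lra.
under eq_bigr do rewrite clampE.
have -> : \sum_(0 <= k < r)
      (if (k < q)%N then 1 else if k == q then f else 0) *: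
      (delta_mx 0 (l k.+1) - delta_mx 0 (l k)) =
    (delta_mx 0 (l q) - delta_mx 0 (l 0%N)) +
    f *: (delta_mx 0 (l q.+1) - delta_mx 0 (l q)) :> 'rV[R]_K.
  rewrite (big_cat_nat (n := q)) //=; last exact: ltnW.
  congr (_ + _).
    rewrite -(telescope_sumr (fun k => delta_mx 0 (l k))) //.
    by apply: eq_big_nat => k /andP[_ ->]; rewrite scale1r.
  rewrite big_ltn // ltnn eqxx big_nat big1 ?addr0 // => k /andP[qk _].
  by rewrite ltnNge ltnW //= gtn_eqF // scale0r.
rewrite addrA [delta_mx 0 (l 0%N) + _]addrC subrK scalerBr scalerBl scale1r.
by rewrite [f *: _ - _]addrC addrA.
Qed.

(** The support shrinks to one vertex at the ends of the segment, whence the hypothesis on all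
    nonempty subsets. *)
Lemma segment_realization (R : realType) (K : nat) (D : {set {set 'I_K}})
    (i j : 'I_K) (f : R) :
    (forall tau, tau != finset.set0 -> tau \subset [set i; j]%SET ->
       tau \in D) ->
    0 <= f <= 1 ->
  realization R D ((1 - f) *: delta_mx 0 i + f *: delta_mx 0 j).
Proof.
move=> faces /andP[f0 f1]; set x := (X in realization _ _ X).
have xE k : x 0 k = (1 - f) * (k == i)%:R + f * (k == j)%:R.
  by rewrite !mxE.
have sum1 h : \sum_(k < K) (k == h)%:R = 1 :> R.
  by rewrite (bigD1 h) //= eqxx big1 ?addr0 // => k /negbTE ->.
have sum_x : \sum_k x 0 k = 1.
  under eq_bigr do rewrite xE.
  rewrite big_split -!mulr_sumr /= !sum1; lra.
split=> //.
- by move=> k; rewrite xE; apply: addr_ge0; apply: mulr_ge0 => //; lra.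
- apply: faces.
    apply/negP => /eqP x0; move: sum_x; rewrite big1 => [/eqP|k _].
      by rewrite eq_sym oner_eq0.
    by apply/eqP; move/finset.setP/(_ k): x0; rewrite !inE => /negbFE.
  apply/fintype.subsetP => k; rewrite !inE xE; apply: contraNT.
  by rewrite negb_or => /andP[/negbTE -> /negbTE ->]; rewrite !mulr0 addr0.
Qed.

(** Cells are closed, so that x = r falls in the last one with f = 1, where rounding down would
    break q < r. *)
Lemma unit_interval_cell (R : realType) (r : nat) (x : R) :
    (0 < r)%N -> 0 <= x <= r%:R ->
  exists q f, [/\ (q < r)%N, 0 <= f <= 1 & x = q%:R + f].
Proof.
elim: r => // r IHr _ /andP[x0 xr].
have [lt_rx|le_xr] := ltP r%:R x.
  exists r, (x - r%:R); split=> //; last by rewrite addrC subrK.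
  by move: xr; rewrite -natr1; lra.
case: r => [|r] in IHr xr le_xr *.
  by exists 0%N, 0; split=> //; rewrite ?lexx ?ler01 //; lra.
have [|q [f [qr f01 ->]]] := IHr isT; first by rewrite x0.
by exists q, f; split=> //; exact: ltnW.
Qed.

(** A ladder joins the labels sampled on the polygon to the walk slowed down M times; each of its
    squares lies in one edge of the walk. *)
Lemma closed_edge_walk_holonomy (R : realType) (K : nat) (gT : groupType)
    (D : {set {set 'I_K}}) (g : 'I_K -> 'I_K -> gT) (l : nat -> 'I_K) (r : nat) :
    simply_connected_complex R D ->
    (forall sigma tau, sigma \in D -> tau != finset.set0 -> tau \subset sigma ->
       tau \in D) ->
    cocycle_on D g -> (forall k, (k < r)%N -> [set l k; l k.+1]%SET \in D) ->
    l 0%N = l r ->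
  walk_holonomy g l r = 1%g.
Proof.
move=> [_ null] faces gD edges l0r.
have [->|r_gt0] := posnP r; first by [].
have cell_in q f : (q < r)%N -> 0 <= f <= 1 ->
    realization R D ((1 - f) *: delta_mx 0 (l q) + f *: delta_mx 0 (l q.+1)).
  move=> qr; apply: segment_realization => tau tau0 tau_s.
  exact: faces (edges q qr) tau0 tau_s.
have polygon_curve : curve_in (realization R D) (polygon l r : R -> _).
  split; first exact/continuous_subspaceT/polygon_continuous.
  move=> t; rewrite /= in_itv /= => /andP[t0 t1].
  have [|q [f [qr f01 def_t]]] := @unit_interval_cell R r (r%:R * t) r_gt0.
    by rewrite mulr_ge0 //= ler_piMr.
  by rewrite (polygonE l qr f01 def_t); exact: cell_in.
have closed : polygon l r 0 = polygon l r 1 :> 'rV[R]_K.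
  rewrite (@polygonE _ _ l r 0 _ 0) ?lexx ?ler01 ?mulr0 ?addr0 //.
  (* Time 1 is the end of the last segment, [r.-1]. *)
  rewrite (@polygonE _ _ l r r.-1 _ 1) ?lexx ?ler01 //; last 2 first.
  - by rewrite prednK.
  - by rewrite mulr1 natr1 prednK.
  by rewrite subr0 subrr !scale1r !scale0r addr0 add0r prednK // l0r.
have [N0 trivial] :=
  null_homotopic_holonomy (l 0%N) gD (null _ polygon_curve closed).
(* As N is a multiple of r, no grid interval straddles two segments; the choice of M gives N >
   N0. *)
pose M := N0.+1; pose N := (r * M)%N.
have N_gt0 : (0 < N)%N by rewrite muln_gt0 r_gt0.
have NR0 : N%:R != 0 :> R by rewrite pnatr_eq0 -lt0n.
have MR0 : M%:R != 0 :> R by rewrite pnatr_eq0.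
have {trivial} := trivial N (leq_pmull _ r_gt0).
set L := (fun b => barycentric_label _ _) => trivial.
have L_edge b q f : (b <= N)%N -> (q < r)%N -> 0 <= f <= 1 ->
    r%:R * (b%:R / N%:R) = q%:R + f :> R ->
    L b \in [set l q; l q.+1]%SET.
  move=> bN qr f01 def_b.
  have : polygon l r (b%:R / N%:R : R) 0 (L b) != 0.
    apply: (barycentric_label_close (D := D)).
      apply: (proj2 polygon_curve); rewrite /= in_itv /= divr_ge0 //=.
      by rewrite ler_pdivrMr ?ltr0n // mul1r ler_nat.
    by apply: ballxx; rewrite invr_gt0 ltr0n; case: (K) (l 0%N) => [[]|].
  rewrite (polygonE l qr f01 def_b) !mxE !inE.
  by apply: contraNT; rewrite negb_or => /andP[/negbTE -> /negbTE ->];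
     rewrite !mulr0 addr0.
have vert q : (q < r)%N -> exists2 sigma, sigma \in D & l q \in sigma.
  by move=> qr; exists [set l q; l q.+1]%SET; [exact: edges|rewrite !inE eqxx].
have ladder := @walk_holonomy_ladder _ _ D g L (fun b => l (b %/ M)%N) N gD.
rewrite (walk_holonomy_refine gD (ltn0Sn N0) vert) trivial mul1g in ladder.
have L0N : L N = L 0%N.
  by rewrite /L mul0r divff // closed.
(* Both walks are closed, so the end rungs agree and cancel. *)
rewrite L0N mulnK // div0n l0r in ladder.
apply: (mulgI (g (L 0%N) (l r))); rewrite mulg1 -ladder // => b bN.
pose q := (b %/ M)%N; have qr : (q < r)%N by rewrite ltn_divLR.
have position j : (b + j = q * M + (b %% M + j))%N by rewrite addnA -divn_eq.
(* Used for j = 0 and j = 1; the right end of a segment is still labelled within its edge. *)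
have cell j : (b %% M + j <= M)%N -> L (b + j)%N \in [set l q; l q.+1]%SET.
  move=> jM; apply: (@L_edge _ _ ((b %% M + j)%N%:R / M%:R)) => //.
  - rewrite position (leq_trans (leq_add (leqnn _) jM)) //.
    by rewrite -mulSnr leq_mul2r qr.
  - by rewrite divr_ge0 //= ler_pdivrMr ?ltr0Sn // mul1r ler_nat.
  - rewrite position natrD !natrM.
    have rR0 : r%:R != 0 :> R by rewrite pnatr_eq0 -lt0n.
    by field; rewrite rR0 MR0.
have bM : (b %% M < M)%N by rewrite ltn_mod.
exists [set l q; l q.+1]%SET; first exact: edges.
split.
- by rewrite -[b]addn0 cell // addn0 ltnW.
- by rewrite -addn1 cell // addn1.
- by rewrite !inE eqxx.
(* The slowed walk moves on to [l q.+1] exactly when [b.+1] completes a block of M. *)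
- rewrite !inE -addn1 position divnMDl //.
  have : (b %% M + 1 <= M)%N by rewrite addn1.
  rewrite leq_eqVlt => /orP[/eqP ->|lt_M].
    by rewrite divnn addn1 eqxx orbT.
  by rewrite divn_small // addn0 eqxx.
Qed.

(** * Gluing the local trivializations *)

Lemma cover_complex_face (n m K : nat) (G : map_graph n m)
    (S : 'I_K -> subgraph G) (sigma tau : {set 'I_K}) :
    sigma \in cover_complex S -> tau != finset.set0 -> tau \subset sigma ->
  tau \in cover_complex S.
Proof.
rewrite !inE => /andP[_ /set0Pn[v /finset.bigcapP vs]] -> /fintype.subsetP ts /=.
by apply/set0Pn; exists v; apply/finset.bigcapP => i /ts; exact: vs.
Qed.

Theorem theorem1 (R : realType) (n m K : nat) (G : map_graph n m)
    (S : 'I_K -> subgraph G)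
    (cover_verts : covers_vertices S)
    (cover_edges : covers_edges S)
    (consistent : forall i, sub_cycle_consistent (S i))
    (normal : forall i j, i != j ->
       [set i; j]%SET \in cover_complex S -> joint_normal (S i) (S j))
    (simply_conn : simply_connected_complex R (cover_complex S)) :
  cycle_consistent G.
Proof.
pose flat i := cid (flat_trivialization (@sedge_sym _ _ _ (S i))
  (@sedge_edge _ _ _ (S i)) (consistent i)).
pose f i := sval (flat i).
have f_inj i v : injective (f i v) by have [] := svalP (flat i).
have f_flat i u v : sedge (S i) u v -> forall x, f i v (phi G u v x) = f i u x.
  by have [_] := svalP (flat i); apply.
have [g gP] : exists g : 'I_K -> 'I_K -> 'S_m, forall i j v,
    v \in sverts (S i) -> v \in sverts (S j) ->
    forall x, g i j (f i v x) = f j v x.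
  suff H i j : exists s : 'S_m, forall v,
      v \in (sverts (S i) :&: sverts (S j))%SET ->
      forall x, s (f i v x) = f j v x.
    exists (fun i j => sval (cid (H i j))) => i j v vi vj.
    by apply: (svalP (cid (H i j))); rewrite inE vi.
  have [-> |ij] := eqVneq i j; first by exists 1%g => v _ x; rewrite perm1.
  have [ST0|ST] := eqVneq (sverts (S i) :&: sverts (S j))%SET finset.set0.
    by exists 1%g => v; rewrite ST0 inE.
  apply: transition => //; [|exact: f_flat..].
  have [|] := normal i j ij; last by case=> // /eqP; rewrite (negbTE ST).
  rewrite inE; apply/andP; split.
    by apply/set0Pn; exists i; rewrite !inE eqxx.
  have /set0Pn[v] := ST; rewrite inE => /andP[vi vj].
  apply/set0Pn; exists v; apply/finset.bigcapP => k.
  by rewrite !inE => /orP[] /eqP ->.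
(* At a vertex shared by all the subgraphs of the simplex, [f i v] is onto, so the identity can be
   checked on its values. *)
have gD : cocycle_on (cover_complex S) g.
  move=> sigma i j k; rewrite inE => /andP[_ /set0Pn[v /finset.bigcapP vs]].
  move=> /vs vi /vs vj /vs vk; apply/permP => t.
  have [x <-] := inj_onto (@f_inj i v) t.
  by rewrite permM !(gP _ _ v).
have [h hP] : exists h : 'I_K -> 'S_m, forall i j,
    [set i; j]%SET \in cover_complex S -> (h i * g i j)%g = h j.
  apply: coboundary => [i j|i p walk closed]; first by rewrite finset.setUC.
  rewrite -nth_walk_holonomy.
  apply: (closed_edge_walk_holonomy simply_conn (@cover_complex_face _ _ _ _ S)).
  - exact: gD.
  - by move=> k kp; apply: (pathP i walk).
  - by rewrite -[in LHS]closed -nth_last; case: (p).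
have [c cP] : exists c : 'I_n -> 'I_K, forall v, v \in sverts (S (c v)).
  suff H v : exists i, v \in sverts (S i).
    by exists (fun v => sval (cid (H v))) => v; exact: svalP (cid (H v)).
  have : v \in [set: 'I_n]%SET by rewrite inE.
  by rewrite -cover_verts => /finset.bigcupP[i _ vi]; exists i.
(* Products of permutations act from left to right, so [h i * g i j = h j] makes the value
   independent of the subgraph chosen around [v]. *)
pose F v x := (h (c v))^-1%g (f (c v) v x).
have FE i v x : v \in sverts (S i) -> F v x = (h i)^-1%g (f i v x).
  move=> vi; rewrite /F -(hP i (c v)); last first.
    rewrite inE; apply/andP; split.
      by apply/set0Pn; exists i; rewrite !inE eqxx.
    apply/set0Pn; exists v; apply/finset.bigcapP => k.
    by rewrite !inE => /orP[] /eqP ->.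
  by rewrite -(gP i (c v) v) // invMg permM permK.
apply: (trivialization_consistent (f := F)) => [v x y /perm_inj/f_inj //|u v].
move=> /cover_edges[i uv] x; have [ui vi] := sedge_verts uv.
(* Both ends of the edge are read in the single subgraph that contains it. *)
by rewrite !(FE i) // f_flat.
Qed.
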